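(* For any $0<\varepsilon<1$, there is a constant $c(\varepsilon)>0$ such that for every integer $n\geq 1$, \[ \Theta_n \geq c(\varepsilon)\,(\log n)^{1-\varepsilon}. \]
   Context: Let $n\ge 1$ and let $\mathrm{vol}$ denote Lebesgue measure on $\mathbf{R}^n$. For $x\in\mathbf{R}^n$ and $r>0$, $Q(x,r)$ denotes the $n$-dimensional (closed, axis-parallel) cube with center $x$ and edge length $2r$, i.e. the ball of radius $r$ about $x$ for $\|\cdot\|_\infty$. For a positive Borel measure $\mu$ on $\mathbf{R}^n$, the cubic centered Hardy--Littlewood maximal function is \[ M\mu(x) := \sup_{r>0} \frac{\mu(Q(x,r))}{\mathrm{vol}(Q(x,r))}. \] $\Theta_n$ denotes the best (smallest) constant $C$ such that for every positive Borel measure $\mu$ on $\mathbf{R}^n$ and every $L>0$, \[ L\cdot \mathrm{vol}\{x\in\mathbf{R}^n : M\mu(x)>L\} \leq C\,\mu(\mathbf{R}^n). \] It is known that such a finite constant exists. The constant $c(\varepsilon)$ depends only on $\varepsilon$, not on $n$; $\log$ is the natural logarithm. *)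

(* Defs.v *)
From HB Require Import structures.
From mathcomp Require Import all_boot all_order all_algebra.
From mathcomp Require Import all_classical all_reals all_analysis.
From mathcomp Require Import measurable_realfun.
Import Order.TTheory GRing.Theory Num.Theory.
Import numFieldNormedType.Exports.

Set Implicit Arguments.
Unset Strict Implicit.
Unset Printing Implicit Defensive.

Local Open Scope classical_set_scope.
Local Open Scope ring_scope.

(* R^n with its Borel sigma-algebra, for the topology of the sup norm. *)
Notation borelRn R n := (g_sigma_algebraType (@open 'rV[R]_n)).

Lemma measurable_fun_borelRn (R : realType) (n : nat) (d : measure_display)
    (T : measurableType d) (f : T -> borelRn R n) :
  (forall U : set 'rV[R]_n, open U -> measurable (f @^-1` U)) ->
  measurable_fun setT f.
Proof.
move=> fU.
apply: (@measurability _ _ T (borelRn R n) setT f (@open 'rV[R]_n)) => //.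
by move=> _ [U oU <-]; rewrite setTI; exact: fU.
Qed.

Section coordinates.
Context {R : realType} (n : nat).

Definition row_cons (p : measurableTypeR R * borelRn R n) : borelRn R n.+1 :=
  row_mx (p.1)%:M p.2 : 'rV[R]_(1 + n).

Definition row_uncons (v : borelRn R n.+1) : measurableTypeR R * borelRn R n :=
  (v 0 0, rsubmx (v : 'rV[R]_(1 + n))).

Lemma row_cons0 p : row_cons p 0 0 = p.1.
Proof.
have -> : 0 = lshift n 0 :> 'I_(1 + n) by apply/val_inj.
by rewrite (@row_mxEl _ 1 1 n) mxE eqxx mulr1n.
Qed.

Lemma row_consS p (j : 'I_n) : row_cons p 0 (rshift 1 j) = p.2 0 j.
Proof. by rewrite (@row_mxEr _ 1 1 n). Qed.

Lemma row_consK : cancel row_cons row_uncons.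
Proof.
by move=> [x v]; rewrite /row_uncons row_cons0 [X in rsubmx X]/row_cons row_mxKr.
Qed.

Lemma open_measurableRn (U : set 'rV[R]_n) :
  open U -> measurable (U : set (borelRn R n)).
Proof. exact: sub_sigma_algebra. Qed.

Lemma closed_measurableRn (F : set 'rV[R]_n) :
  closed F -> measurable (F : set (borelRn R n)).
Proof.
move=> /closed_openC/open_measurableRn/measurableC; rewrite setCK; exact.
Qed.

Lemma measurable_row_uncons : measurable_fun setT row_uncons.
Proof.
apply: measurable_fun_pair.
  apply: (measurability _ (RGenOpens.measurableE R)).
  move=> _ [_ [a [b ->] <-]]; rewrite setTI.
  apply: sub_sigma_algebra.
  have /continuousP := @coord_continuous R 1 n.+1 0 0.
  by apply; exact: interval_open.
apply: measurable_fun_borelRn => U oU; apply: sub_sigma_algebra.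
rewrite openE => v Uv; have /nbhs_ballP[e e0 eU] := open_nbhs_nbhs (conj oU Uv).
apply/nbhs_ballP; exists e => //= w [_ vw]; apply: eU; split => // i j.
by rewrite !mxE; exact: vw.
Qed.

Lemma open_mx_ball (q : 'rV[R]_n) (e : R) : 0 < e -> open (ball q e).
Proof.
move=> e0; rewrite openE => v [_ qv].
exists (fun i j => ball (q i j) e).
  by move=> i j; apply: open_nbhs_nbhs; split; [exact: ball_open|exact: qv].
by move=> w qw; split.
Qed.

End coordinates.

Lemma measurable_row_cons (R : realType) (n : nat) :
  measurable_fun setT (@row_cons R n).
Proof.
apply: measurable_fun_borelRn => U oU.
pose B (qk : 'rV[rat]_n.+1 * nat) : set 'rV[R]_n.+1 :=
  ball (map_mx (@ratr R) qk.1) qk.2.+1%:R^-1.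
have -> : U = \bigcup_(qk in [set qk | B qk `<=` U]) B qk.
  apply/seteqP; split => [v Uv|v [qk /= BU /BU//]].
  have /nbhs_ballP[e /= e0 eU] := open_nbhs_nbhs (conj oU Uv).
  have [k ke] : exists k, k.+1%:R^-1 < e / 2.
    have e20 : 0 < e / 2 by rewrite divr_gt0.
    exists (Num.truncn (e / 2)^-1).
    by rewrite invf_plt ?posrE// truncnS_gt.
  have k0 : 0 < k.+1%:R^-1 :> R by rewrite invr_gt0.
  have /all_sig[q vq] (j : 'I_n.+1) :
      {q : rat | `|v 0 j - ratr q| < k.+1%:R^-1}.
    apply: cid.
    have [] := @dense_rat R (ball (v 0 j) k.+1%:R^-1).
    - by exists (v 0 j); exact: ballxx.
    - exact: ball_open.
    by move=> x [/= vq [q _ qE]]; exists q; rewrite qE.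
  have Bv : ball (map_mx (@ratr R) (\row_j q j)) k.+1%:R^-1 v.
    by split => // i j; rewrite ord1 !mxE; apply: ball_sym; exact: vq.
  exists (\row_j q j, k) => //= w Bw; apply: eU.
  apply: (@le_ball _ _ _ (k.+1%:R^-1 + k.+1%:R^-1)).
    by rewrite [leRHS]splitr lerD// ltW.
  exact: ball_triangle (ball_sym Bv) Bw.
rewrite preimage_bigcup; rewrite bigcup_mkcond; apply: countable_bigcupT_measurable => [|[q k]].
  exact: countableP.
case: ifPn => _ //=.
rewrite /B/=.
pose e : R := k.+1%:R^-1.
have -> : @row_cons R n @^-1` B (q, k) =
    ball (ratr (q 0 0) : R) e `*` ball (\row_j ratr (q 0 (rshift 1 j)) : 'rV[R]_n) e.
  apply/seteqP; split => [[x v] [_ qxv]|[x v] [/= qx [_ qv]]].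
    split; first by have := qxv 0 0; rewrite mxE row_cons0.
    split; first by rewrite invr_gt0.
    move=> i j; have := qxv 0 (rshift 1 j).
    by rewrite row_consS ord1 !mxE.
  split; first by rewrite invr_gt0.
  move=> i j; rewrite ord1 mxE.
  have [j' ->|j' ->] := @split_ordP 1 n j.
    have -> : lshift n j' = 0 by apply/val_inj; rewrite /= ord1.
    by rewrite row_cons0.
  by rewrite row_consS; have := qv 0 j'; rewrite mxE.
apply: measurableX.
  apply: open_measurable; exact: ball_open.
apply: open_measurableRn; apply: open_mx_ball.
by rewrite invr_gt0.
Qed.

Section prod_lebesgue.
Context {R : realType} (n : nat).
Variable m : {sigma_finite_measure set (borelRn R n) -> \bar R}.

Definition prod_lebesgue : set (borelRn R n.+1) -> \bar R :=
  pushforward (@lebesgue_measure R \x m)%E (@row_cons R n).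

HB.instance Definition _ := Measure.copy prod_lebesgue
  (measure_function_pushforward__canonical__measure_function_Measure
    _ (@measurable_row_cons R n)).

Let prod_lebesgue_sigma_finite : sigma_finite setT prod_lebesgue.
Proof.
have /sigma_finiteP[F [FT ndF Foo]] := sigma_finiteT (@lebesgue_measure R).
have /sigma_finiteP[G [GT ndG Goo]] := sigma_finiteT m.
exists (fun k => @row_uncons R n @^-1` (F k `*` G k)).
  apply/esym; rewrite -subTset => v _.
  have [i _ Fi] : (\bigcup_i F i) (row_uncons v).1 by rewrite -FT.
  have [j _ Gj] : (\bigcup_j G j) (row_uncons v).2 by rewrite -GT.
  exists (maxn i j) => //; split.
    by move: Fi; exact/subsetPset/ndF/leq_maxl.
  by move: Gj; exact/subsetPset/ndG/leq_maxr.
move=> k; have [mF Fk] := Foo k; have [mG Gk] := Goo k; split.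
  rewrite -[X in measurable X]setTI; apply: measurable_row_uncons => //.
  exact: measurableX.
rewrite /prod_lebesgue /pushforward -comp_preimage.
rewrite (_ : _ \o _ = id); last by apply/funext => p; exact: row_consK.
by rewrite product_measure1E// lte_mul_pinfty// ge0_fin_numE.
Qed.

HB.instance Definition _ :=
  Measure_isSigmaFinite.Build _ _ _ prod_lebesgue prod_lebesgue_sigma_finite.

End prod_lebesgue.

(* Lebesgue measure on R^n, as an iterated product measure; vol_box below is
   the property that characterizes it. *)
Fixpoint vol {R : realType} (n : nat) :
    {sigma_finite_measure set (borelRn R n) -> \bar R} :=
  match n with
  | 0 => @dirac _ (borelRn R 0) (0 : 'rV[R]_0) R
  | n'.+1 => @prod_lebesgue R n' (vol n')
  end.

Lemma vol_box (R : realType) (n : nat) (a b : 'rV[R]_n) :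
  (forall i, a 0 i <= b 0 i) ->
  vol n [set y | forall i, a 0 i <= y 0 i <= b 0 i] =
  (\prod_i (b 0 i - a 0 i))%:E.
Proof.
elim: n a b => [|n IHn] a b ab.
  by rewrite big_ord0 /= diracE mem_set//= => -[].
pose a' : 'rV_n := rsubmx (a : 'rV_(1 + n)).
pose b' : 'rV_n := rsubmx (b : 'rV_(1 + n)).
rewrite big_ord_recl EFinM.
transitivity ((@lebesgue_measure R \x vol n)%E (`[a 0 0, b 0 0] `*`
    [set y : borelRn R n | forall i, a' 0 i <= y 0 i <= b' 0 i])).
  congr product_measure1.
  apply/seteqP; split => [[x v] abxv|[x v] [abx abv] j] /=.
    split; first by have := abxv 0; rewrite row_cons0 /= in_itv.
    by move=> i; have := abxv (rshift 1 i); rewrite row_consS !mxE.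
  have [j' ->|j' ->] := @split_ordP 1 n j.
    have -> : lshift n j' = 0 by apply/val_inj; rewrite /= ord1.
    by rewrite row_cons0; move: abx; rewrite /= in_itv.
  by rewrite row_consS; have := abv j'; rewrite !mxE.
rewrite product_measure1E//; last first.
  rewrite [X in measurable X](_ : _ =
      \bigcap_(i : 'I_n) ((fun y : 'rV[R]_n => y 0 i) @^-1` `[a' 0 i, b' 0 i])).
    apply: closed_measurableRn; apply: closed_bigI => i _.
    have /continuous_closedP := @coord_continuous R 1 n 0 i.
    by apply; exact: itv_closed.
  apply/seteqP; split => y /= aby i; first by move=> _; rewrite /= in_itv; exact: aby.
  by have := aby i I; rewrite /= in_itv.
congr (_ * _)%E.
  rewrite [LHS](@lebesgue_measure_itv R)/= lte_fin.
  case: ifPn => //; rewrite -leNgt => ba.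
  have /eqP -> : a 0 0 == b 0 0 by rewrite eq_le ab ba.
  by rewrite subrr.
rewrite IHn; last by move=> i; rewrite !mxE; exact: ab.
congr _%:E; apply: eq_bigr => i _; rewrite !mxE.
by congr (b 0 _ - a 0 _); apply/val_inj.
Qed.

Section maximal.
Context {R : realType} {n : nat}.

Definition cube (x : borelRn R n) (r : R) : set (borelRn R n) :=
  [set y | forall i, `|y 0 i - x 0 i| <= r].

Local Open Scope ereal_scope.

Definition maximal (mu : {measure set (borelRn R n) -> \bar R})
    (x : borelRn R n) : \bar R :=
  ereal_sup [set mu (cube x r) / vol n (cube x r) | r in [set r : R | (0 < r)%R]].

End maximal.

(* The best constant lives in \bar R: it is +oo should no real C be
   admissible. *)
Definition Theta (R : realType) (n : nat) : \bar R :=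
  ereal_inf [set C%:E | C in [set C : R |
    forall (mu : {measure set (borelRn R n) -> \bar R}) (L : R), 0 < L ->
      (L%:E * vol n [set x | L%:E < maximal mu x] <= C%:E * mu setT)%E]].

(* Main.v *)
Require Import Defs.
From HB Require Import structures.
From mathcomp Require Import all_boot all_order all_algebra.
From mathcomp Require Import all_classical all_reals all_analysis.
From mathcomp Require Import ring lra zify.
Import Order.TTheory GRing.Theory Num.Theory.
Import numFieldNormedType.Exports.

Set Implicit Arguments.
Unset Strict Implicit.
Unset Printing Implicit Defensive.

Local Open Scope ring_scope.

(** The lower bound comes from a product of randomly perturbed lattices.

In the [i]-th coordinate take the points [k + b_i(k)], for [0 <= k < D], where
the [b_i(k)] are independent fair bits, and let [mu] put a unit mass at each
point of the product of these [n] sets; thus [mu] has mass [D ^ n].  The closed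
interval of radius [N] about a point of [[c, c + 1]] contains at least the
points lying in the integer window [c + 1 - N, ..., c + N], and there are
exactly [2N + b_i(c - N) - b_i(c + N)] of them: only the two points next to the
ends of the window are uncertain.  Hence, on the unit cell with lowest corner
[(c_i)], the maximal function is at least each of the random products

  [X_N = \prod_i (1 + (b_i(c_i - N) - b_i(c_i + N)) / 2N)].

The products belonging to distinct radii involve distinct bits, so they are
independent.  A single [X_N] has mean 1, but [X_N ^ 2] has mean
[v_N = (1 + 1 / 8N^2) ^ n] and second moment at most [(1 + 1 / N^2) ^ n].  With
[m] radii in [[m, 2m)] and [8 (1 + 1 / m^2) ^ n <= m], Chebyshev's inequality
for the sum of the [X_N ^ 2] ([card_all_below_half_mean]) shows that, with
probability at least one half, some [X_N ^ 2] exceeds [v_N / 2]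
([half_fluct_prod_large]).  Averaging over the cells ([exists_majority]) gives a
choice of the bits for which at least half of the cells lie in the set where the
maximal function exceeds [L], as soon as [2 L ^ 2 < (1 + 1 / 32m^2) ^ n].  If
[D] is large compared with [n m], the cells whose windows stay inside [[0, D)]
fill at least half of [[0, D) ^ n], and [L / 4 <= Theta R n] follows
([Theta_ge]).

It remains to choose [m] of order [sqrt (n / (1 + ln n))]: then
[(1 + 1 / m^2) ^ n] and the admissible [L] are both powers of [n] with a small
positive exponent ([Theta_ge_expR]), and a power of [n] dominates every power
of [ln n]. *)

(** * Means over finite probability spaces *)

Section mean.
Variable R : realFieldType.
Implicit Types T I J : finType.

Definition mean T (F : T -> R) : R := (\sum_t F t) / #|T|%:R.

Lemma eq_mean T (F G : T -> R) : F =1 G -> mean F = mean G.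
Proof. by move=> FG; rewrite /mean (eq_bigr G). Qed.

Lemma meanD T (F G : T -> R) : mean (fun t => F t + G t) = mean F + mean G.
Proof. by rewrite /mean big_split mulrDl. Qed.

Lemma meanZ T (a : R) (F : T -> R) : mean (fun t => a * F t) = a * mean F.
Proof. by rewrite /mean -mulr_sumr mulrA. Qed.

Lemma mean_sum T (J : finType) (F : J -> T -> R) :
  mean (fun t => \sum_j F j t) = \sum_j mean (F j).
Proof. by rewrite /mean exchange_big /= mulr_suml. Qed.

Lemma mean_cst T (a : R) : (0 < #|T|)%N -> mean (fun _ : T => a) = a.
Proof.
move=> T0; rewrite /mean sumr_const -[X in X / _]mulr_natr -mulrA mulfV ?mulr1//.
by rewrite pnatr_eq0 -lt0n.
Qed.

(** Independence of the rows of a random matrix of bits. *)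
Lemma mean_prod I T (F : I -> T -> R) :
  mean (fun b : {ffun I -> T} => \prod_i F i (b i)) = \prod_i mean (F i).
Proof.
rewrite /mean big_split /= prodr_const card_ffun natrX exprVn.
by rewrite (bigA_distr_bigA F).
Qed.

Lemma markov_card T (F : T -> R) (a : R) : (forall t, 0 <= F t) ->
  a * #|[set t | a <= F t]%SET|%:R <= mean F * #|T|%:R.
Proof.
move=> F0; rewrite /mean.
have [T0|T0] := posnP #|T|.
  by rewrite (_ : #|_| = 0)%N ?T0 ?mulr0//; apply/eqP; rewrite -leqn0 -T0 max_card.
rewrite divfK ?pnatr_eq0 -?lt0n//.
rewrite -sumr_const mulr_sumr big_mkcond /=.
apply: ler_sum => t _; rewrite inE.
by case: ifPn => [aF|_//]; rewrite mulr1.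
Qed.

(** Chebyshev's inequality for the sum of the [Y s].  Pairwise independence makes
its variance at most [m K], while its mean [V] is at least [m]; if every [Y s]
is at most half of its mean, then the sum deviates from [V] by at least
[V / 2 >= m / 2]. *)
Lemma card_all_below_half_mean T m (Y : 'I_m -> T -> R) (v : 'I_m -> R) (K : R) :
  (0 < #|T|)%N -> (0 < m)%N ->
  (forall s, mean (Y s) = v s) ->
  (forall s t, s != t -> mean (fun w => Y s w * Y t w) = v s * v t) ->
  (forall s, mean (fun w => Y s w ^+ 2) <= K) ->
  (forall s, 1 <= v s) ->
  8 * K <= m%:R ->
  2 * #|[set w | [forall s, Y s w <= v s / 2]]%SET|%:R <= #|T|%:R :> R.
Proof.
move=> T0 m0 Yv Yvv YK v1 Km.
pose V := \sum_s v s.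
pose W w := (\sum_s Y s w - V) ^+ 2.
have mV : m%:R <= V.
  by rewrite -[m in m%:R]card_ord -sumr_const; apply: ler_sum.
have m0' : 0 < m%:R :> R by rewrite ltr0n.
have var : mean W <= m%:R * K.
  have -> : mean W = \sum_s (mean (fun w => Y s w ^+ 2) - v s ^+ 2).
    (* the terms with s != t cancel against the square of the mean *)
    transitivity (mean (fun w => (\sum_s \sum_t Y s w * Y t w) +
        ((- (2 * V)) * (\sum_s Y s w) + V ^+ 2))).
      apply: eq_mean => w; rewrite /W.
      have -> : \sum_s \sum_t Y s w * Y t w = (\sum_s Y s w) ^+ 2.
        by rewrite expr2 mulr_suml; apply: eq_bigr => s _; rewrite mulr_sumr.
      ring.
    rewrite !meanD meanZ !mean_sum mean_cst//.
    rewrite (_ : \sum_s mean (Y s) = V); last exact: eq_bigr.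
    have -> : \sum_s mean (fun w => \sum_t Y s w * Y t w) =
        \sum_s (mean (fun w => Y s w ^+ 2) - v s ^+ 2) + V ^+ 2.
      rewrite expr2 {1}/V mulr_suml -big_split /=; apply: eq_bigr => s _.
      rewrite mean_sum (bigD1 s)//= [V in RHS](bigD1 s)//=.
      rewrite (eq_bigr (fun t => v s * v t)); last first.
        by move=> t ts; apply: Yvv; rewrite eq_sym.
      have -> : mean (fun w => Y s w * Y s w) = mean (fun w => Y s w ^+ 2).
        by apply: eq_mean => w; rewrite expr2.
      by rewrite -mulr_sumr; ring.
    ring.
  have -> : m%:R * K = \sum_(s < m) K by rewrite sumr_const card_ord mulr_natl.
  by apply: ler_sum => s _; have := YK s; have := v1 s; nra.
have bad : #|[set w | [forall s, Y s w <= v s / 2]]%SET|%:R <=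
    #|[set w | m%:R ^+ 2 / 4 <= W w]%SET|%:R :> R.
  rewrite ler_nat; apply/subset_leq_card/fintype.subsetP => w; rewrite !inE => /forallP Yw.
  have : \sum_s Y s w <= V / 2 by rewrite mulr_suml; apply: ler_sum.
  by rewrite /W => ?; nra.
have := @markov_card _ W (m%:R ^+ 2 / 4) (fun w => sqr_ge0 _).
set B := #|_|%:R in bad *; set B' := #|_|%:R in bad *; set t := #|T|%:R.
move=> mB; have t0 : 0 <= t by rewrite ler0n.
have {}mB : m%:R ^+ 2 * (2 * B) <= m%:R ^+ 2 * t.
  have h1 : m%:R ^+ 2 * B <= m%:R ^+ 2 * B'.
    by apply: ler_wpM2l => //; exact: sqr_ge0.
  have h2 : mean W * t <= m%:R * K * t by exact: ler_wpM2r.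
  have h3 : (m%:R * t) * (8 * K) <= (m%:R * t) * m%:R.
    by apply: ler_wpM2l => //; exact: mulr_ge0 (ltW _) _.
  by lra.
by rewrite -(ler_pM2l (exprn_gt0 2 m0')).
Qed.

End mean.

(** * Moments of the fluctuation carried by two random bits *)

Section bits.
Variables (R : realFieldType) (K : finType).
Implicit Types c : {ffun K -> bool}.

Definition flip (k : K) c : {ffun K -> bool} := [ffun i => c i (+) (i == k)].

Lemma flipK k : involutive (flip k).
Proof. by move=> c; apply/ffunP => i; rewrite !ffunE addbK. Qed.

Lemma flip_eq k c : flip k c k = ~~ c k.
Proof. by rewrite ffunE eqxx addbT. Qed.

Lemma flip_neq k i c : i != k -> flip k c i = c i.
Proof. by move=> /negbTE ik; rewrite ffunE ik addbF. Qed.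

Lemma mean_flip k (F : {ffun K -> bool} -> R) :
  mean (fun c => F (flip k c)) = mean F.
Proof. by rewrite /mean [in RHS](reindex_inj (inv_inj (flipK k))). Qed.

(** Flipping one bit preserves the uniform measure, so the mean over all bit
strings may first be averaged over the four values of the bits at [p] and [q].
The function [G] is one that does not depend on those two bits. *)
Lemma mean_two_bits (p q : K) (f : bool -> bool -> R) (G : {ffun K -> bool} -> R) :
  p != q -> (forall c, G (flip p c) = G c) -> (forall c, G (flip q c) = G c) ->
  mean (fun c => f (c p) (c q) * G c) =
  (f false false + f false true + f true false + f true true) / 4 * mean G.
Proof.
move=> pq Gp Gq; pose F c := f (c p) (c q) * G c.
have -> : mean F = mean (fun c =>
    4^-1 * (F c + F (flip p c) + (F (flip q c) + F (flip p (flip q c))))).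
  rewrite meanZ !meanD (mean_flip p F) (mean_flip q F).
  rewrite (mean_flip q (fun c => F (flip p c))) (mean_flip p F).
  by rewrite -/F; field.
rewrite -meanZ; apply: eq_mean => c; rewrite /F !(Gp, Gq) !flip_eq.
have qp : q != p by rewrite eq_sym.
rewrite !(flip_neq _ pq) !(flip_neq _ qp) !flip_eq.
by case: (c p); case: (c q) => /=; field.
Qed.

(** With [h = 1 / 2N] this is the ratio to [2N] of the number of perturbed lattice
points in a window of length [2N] whose ends are governed by the bits at [p] and
[q]. *)
Definition fluct (h : R) (p q : K) c : R := 1 + h * ((c p)%:R - (c q)%:R).

Lemma fluct_ge0 h p q c : 0 <= h <= 1 -> 0 <= fluct h p q c.
Proof. by rewrite /fluct; case: (c p); case: (c q) => /= /andP[h0 h1]; lra. Qed.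

Lemma fluct_flip h p q k c : p != k -> q != k -> fluct h p q (flip k c) = fluct h p q c.
Proof. by move=> pk qk; rewrite /fluct !flip_neq. Qed.

Lemma mean_fluct_exp h p q e : p != q ->
  mean (fun c => fluct h p q c ^+ e) =
  (2 + (1 - h) ^+ e + (1 + h) ^+ e) / 4.
Proof.
move=> pq; have := @mean_two_bits p q (fun x y => (1 + h * (x%:R - y%:R)) ^+ e)
  (fun=> 1) pq (fun=> erefl) (fun=> erefl).
rewrite mean_cst ?card_ffun ?card_bool ?expn_gt0// mulr1.
under eq_mean do rewrite mulr1.
rewrite /fluct => ->; rewrite !subrr !mulr0 !addr0 subr0 sub0r expr1n mulr1 mulrN1.
by field.
Qed.

Lemma mean_fluct_sqr h p q : p != q ->
  mean (fun c => fluct h p q c ^+ 2) = 1 + h ^+ 2 / 2.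
Proof. by move=> pq; rewrite mean_fluct_exp//; field. Qed.

Lemma mean_fluct_4 h p q : p != q ->
  mean (fun c => fluct h p q c ^+ 4) = 1 + 3 * h ^+ 2 + h ^+ 4 / 2.
Proof. by move=> pq; rewrite mean_fluct_exp//; field. Qed.

Lemma mean_fluct_indep h h' p q p' q' : uniq [:: p; q; p'; q'] ->
  mean (fun c => fluct h p q c ^+ 2 * fluct h' p' q' c ^+ 2) =
  (1 + h ^+ 2 / 2) * (1 + h' ^+ 2 / 2).
Proof.
rewrite /= !inE !negb_or => /and4P[/and3P[pq pp' pq'] /andP[qp' qq'] p'q' _].
have := @mean_two_bits p q (fun x y => (1 + h * (x%:R - y%:R)) ^+ 2)
  (fun c => fluct h' p' q' c ^+ 2) pq.
rewrite mean_fluct_sqr// => ->; last 2 first.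
- by move=> c; rewrite fluct_flip// eq_sym.
- by move=> c; rewrite fluct_flip// eq_sym.
by congr (_ * _) => /=; field.
Qed.

End bits.

(** * Products of independent fluctuations *)

Section rows.
Variables (R : realFieldType) (K : finType) (n : nat).

Definition fluct_prod (h : R) (p q : 'I_n -> K) (b : {ffun 'I_n -> {ffun K -> bool}}) : R :=
  \prod_i fluct h (p i) (q i) (b i).

(** Second moments of the [m] products are the means of their squares, and
fourth moments control the variances: [E X^2 = (1 + h^2 / 2)^n >= 1] and
[E X^4 = (1 + 3 h^2 + h^4 / 2)^n <= (1 + 4 h^2)^n].  The first moments would be
of no help, as each product has mean 1. *)
Lemma half_fluct_prod_large m (h : 'I_m -> R) (p q : 'I_m -> 'I_n -> K) (d : R) :
  (0 < m)%N ->
  (forall s i, p s i != q s i) ->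
  (forall s t i, s != t -> uniq [:: p s i; q s i; p t i; q t i]) ->
  (forall s, 0 <= h s <= 1) -> (forall s, 4 * h s ^+ 2 <= d) ->
  8 * (1 + d) ^+ n <= m%:R ->
  (2 * #|[set b | [forall s, (fluct_prod (h s) (p s) (q s) b ^+ 2
                     <= (1 + h s ^+ 2 / 2) ^+ n / 2)%R]]%SET|
   <= #|{ffun 'I_n -> {ffun K -> bool}}|)%N.
Proof.
move=> m0 pq pqpq h01 hd dm; rewrite -(ler_nat R) natrM.
apply: (@card_all_below_half_mean _ _ m (fun s b => fluct_prod (h s) (p s) (q s) b ^+ 2)
  (fun s => (1 + h s ^+ 2 / 2) ^+ n) ((1 + d) ^+ n)) => //.
- by apply/card_gt0P; exists [ffun=> [ffun=> false]].
- move=> s; under eq_mean do rewrite /fluct_prod -prodrXl.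
  rewrite (mean_prod (fun i c => fluct (h s) (p s i) (q s i) c ^+ 2)).
  under eq_bigr do rewrite mean_fluct_sqr//.
  by rewrite prodr_const card_ord.
- move=> s t st; under eq_mean do rewrite /fluct_prod -!prodrXl -big_split /=.
  rewrite (mean_prod (fun i c => fluct (h s) (p s i) (q s i) c ^+ 2 *
                                 fluct (h t) (p t i) (q t i) c ^+ 2)).
  under eq_bigr do rewrite mean_fluct_indep ?pqpq//.
  by rewrite big_split /= !prodr_const card_ord.
- move=> s; under eq_mean do rewrite -exprM /fluct_prod -prodrXl.
  rewrite (mean_prod (fun i c => fluct (h s) (p s i) (q s i) c ^+ 4)).
  under eq_bigr do rewrite mean_fluct_4//.
  rewrite prodr_const card_ord; have /andP[h0 h1] := h01 s; have {}hd := hd s.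
  have h2 : h s ^+ 2 <= 1 by rewrite expr_le1.
  have h20 : 0 <= h s ^+ 2 by exact: sqr_ge0.
  have h4 : h s ^+ 4 <= h s ^+ 2.
    by rewrite (exprM _ 2 2) expr2 ler_piMl.
  have h40 : 0 <= h s ^+ 4 by exact: exprn_ge0.
  by rewrite lerXn2r// ?nnegrE; lra.
- by move=> s; rewrite exprn_ege1// lerDl divr_ge0// sqr_ge0.
Qed.

End rows.

(** * Counting *)

Section counting.
Local Open Scope nat_scope.


(** Double counting: a proportion that is at most one half for each [j] is at most
one half on average over [b]. *)
Lemma exists_majority (B J : finType) (bad : J -> B -> bool) : 0 < #|B| ->
  (forall j, 2 * #|[set b | bad j b]%SET| <= #|B|) ->
  exists b, 2 * #|[set j | bad j b]%SET| <= #|J|.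
Proof.
move=> B0 Hj; apply/existsP; apply: contraT; rewrite negb_exists => /forallP Hb.
have : \sum_(b : B) #|J|.+1 <= \sum_b 2 * #|[set j | bad j b]%SET|.
  by apply: leq_sum => b _; rewrite ltnNge Hb.
have -> : \sum_b 2 * #|[set j | bad j b]%SET| = \sum_j 2 * #|[set b | bad j b]%SET|.
  rewrite -!big_distrr /=; congr (2 * _).
  transitivity (\sum_b \sum_j (bad j b : nat)).
    by apply: eq_bigr => b _; rewrite -sum1dep_card big_mkcond.
  rewrite exchange_big; apply: eq_bigr => j _ /=.
  by rewrite -sum1dep_card [RHS]big_mkcond.
have : \sum_j 2 * #|[set b | bad j b]%SET| <= \sum_(j : J) #|B| by exact: leq_sum.
rewrite !sum_nat_const => h1 h2; have := leq_trans h2 h1.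
by rewrite (mulnC #|J|) leq_pmul2l// ltnn.
Qed.

(** The points [k + c k] in the window [p + 1, ..., p + 2 N] come from the
[2 N - 1] indices strictly between [p] and [p + 2 N], whatever their bits, from
[k = p] when its bit is set, and from [k = p + 2 N] when its bit is not set. *)
Lemma card_window D (c : {ffun 'I_D -> bool}) (N : nat) (p q : 'I_D) : 0 < N ->
  q = p + 2 * N :> nat ->
  2 * N + c p <= #|[set k : 'I_D | p < k + c k <= p + 2 * N]%SET| + c q.
Proof.
move=> N0 qpN; have qD := ltn_ord q.
rewrite -sum1dep_card big_mkcond /=.
have qp : q != p by apply/eqP => /(congr1 val) /=; lia.
rewrite (bigD1 p)//= (bigD1 q)//=.
rewrite -qpN.
have : 2 * N - 1 <= \sum_(i | (i != p) && (i != q)) (if p < i + c i <= q then 1 else 0).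
  have inD (t : 'I_(2 * N - 1)) : p + t.+1 < D by have := ltn_ord t; lia.
  pose f t := Ordinal (inD t).
  have f_inj : injective f by move=> t u /(congr1 val) /= tu; apply/val_inj => /=; lia.
  rewrite -[leqLHS]card_ord -[leqLHS](card_imset _ f_inj).
  rewrite -sum1_card [leqRHS]big_mkcond [leqLHS]big_mkcond /=.
  apply: leq_sum => k _; case: ifPn => // /imsetP[t _ ->].
  have tN := ltn_ord t.
  rewrite -!(inj_eq val_inj) /= ifT; last by apply/andP; split; apply/eqP; lia.
  by rewrite ifT//; case: (c _) => /=; lia.
by case: (c p); case: (c q) => /=; rewrite ?addn0 ?ltnn ?leqnn /=; repeat case: ifP; lia.
Qed.

Lemma card_box (I T : finType) (P : I -> pred T) :
  #|[set k : {ffun I -> T} | [forall i, P i (k i)]]%SET| = \prod_i #|[set t | P i t]%SET|.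
Proof.
transitivity #|family P|; first by apply: eq_card => k; rewrite inE.
rewrite card_family foldrE big_map big_enum /=; apply: eq_bigr => i _.
by apply: eq_card => t; rewrite inE.
Qed.

End counting.

(** * Cubes, cells and the level sets of the maximal function *)

Local Open Scope classical_set_scope.

Section measure.
Variables (R : realType) (n : nat).

Lemma measurable_box (a b : 'rV[R]_n) :
  measurable ([set y | forall i, a 0 i <= y 0 i <= b 0 i] : set (borelRn R n)).
Proof.
rewrite [X in measurable X](_ : _ =
    \bigcap_(i : 'I_n) ((fun y : 'rV[R]_n => y 0 i) @^-1` `[a 0 i, b 0 i])).
  apply: closed_measurableRn; apply: closed_bigI => i _.
  have /continuous_closedP := @coord_continuous R 1 n 0 i.
  by apply; exact: itv_closed.
apply/seteqP; split => y /= aby i; first by move=> _; rewrite /= in_itv; exact: aby.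
by have := aby i I; rewrite /= in_itv.
Qed.

Lemma cubeE (x : borelRn R n) (r : R) :
  cube x r = [set y | forall i, (x - const_mx r) 0 i <= y 0 i <= (x + const_mx r) 0 i].
Proof.
by apply/seteqP; split => y /= yx i; have := yx i; rewrite !mxE ler_distl.
Qed.

Lemma measurable_cube (x : borelRn R n) (r : R) : measurable (cube x r).
Proof. by rewrite cubeE; exact: measurable_box. Qed.

Lemma vol_cube (x : borelRn R n) (r : R) : 0 <= r ->
  vol n (cube x r) = ((2 * r) ^+ n)%:E.
Proof.
move=> r0; rewrite cubeE vol_box; last by move=> i; rewrite !mxE lerD2l ge0_cp.
congr _%:E; rewrite -[n in RHS]card_ord -prodr_const.
by apply: eq_bigr => i _; rewrite !mxE; ring.
Qed.

(** If the cube of radius [r] about [x] beats the level [L], then so does a slightly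
larger radius [r'] with the same mass; the cubes of radius [r'] about points
close to [x] contain the original cube. *)
Lemma open_maximal_gt (mu : {measure set (borelRn R n) -> \bar R}) (L : R) :
  open [set x : 'rV[R]_n | L%:E < maximal mu x]%E.
Proof.
rewrite openE => x /ereal_sup_gt[_ [r /= r0 <-]].
have vE s : 0 < s -> 0 < (2 * s) ^+ n by move=> s0; rewrite exprn_gt0// mulr_gt0.
rewrite vol_cube ?ltW// inver gt_eqF ?vE// lte_pdivlMr ?vE// -EFinM => Lr.
have [r' rr' Lr'] : exists2 r', r < r' & ((L * (2 * r') ^+ n)%:E < mu (cube x r))%E.
  have [[y yE]|yoo] : (exists2 y, L * (2 * r) ^+ n < y & y%:E = mu (cube x r)) \/
      mu (cube x r) = +oo%E.
    by case: (mu _) Lr => // [y|_]; [left; exists y|right].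
  - have /cvgr_lt/(_ _ yE) : (fun s : R => L * (2 * s) ^+ n) @ r --> L * (2 * r) ^+ n.
      apply: cvgM; first exact: cvg_cst.
      apply: (@cvg_comp _ _ _ ( *%R 2) (fun s : R => s ^+ n) _ (nbhs (2 * r))).
        exact: mulrl_continuous.
      exact: exprn_continuous.
    move=> /nbhs_ballP[e /= e0 re] <-; exists (r + e / 2).
      by rewrite ltrDl divr_gt0.
    rewrite lte_fin; apply: re; rewrite /ball/= opprD addrA subrr sub0r normrN.
    by rewrite gtr0_norm ?divr_gt0// ltr_pdivrMr// ltr_pMr// ltr1n.
  - by exists (r + 1); rewrite ?ltrDl// yoo ltry.
apply/nbhs_ballP; exists (r' - r) => /=; first by rewrite subr_gt0.
move=> x' [_ xx'] /=; have r'0 : 0 < r' by exact: lt_trans rr'.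
apply: (@lt_le_trans _ _ (mu (cube x' r') / vol n (cube x' r'))%E); last first.
  by apply: ereal_sup_ubound; exists r'.
rewrite vol_cube ?ltW// inver gt_eqF ?vE// lte_pdivlMr ?vE// -EFinM.
apply: lt_le_trans Lr' _; apply: le_measure; rewrite ?inE; try exact: measurable_cube.
move=> y /= xy i; have := xy i; have /ltW := xx' 0 i => h1 h2.
rewrite (_ : y 0 i - x' 0 i = (y 0 i - x 0 i) + (x 0 i - x' 0 i)); last by ring.
by apply: (le_trans (ler_normD _ _)); rewrite -[leRHS](subrKC r) lerD.
Qed.

Lemma measurable_maximal_gt (mu : {measure set (borelRn R n) -> \bar R}) (L : R) :
  measurable ([set x | L%:E < maximal mu x]%E : set (borelRn R n)).
Proof. by apply: open_measurableRn; exact: open_maximal_gt. Qed.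

Definition cell (a : nat) E (j : {ffun 'I_n -> 'I_E}) : set (borelRn R n) :=
  [set x | forall i, (a + j i)%:R <= x 0 i <= (a + j i).+1%:R].

Let cellE a E j : @cell a E j =
  [set x | forall i, (\row_i (a + j i)%:R : 'rV[R]_n) 0 i <= x 0 i <=
                     (\row_i (a + j i).+1%:R : 'rV[R]_n) 0 i].
Proof. by apply/seteqP; split => x /= jx i; have := jx i; rewrite !mxE. Qed.

Lemma measurable_cell a E j : measurable (@cell a E j).
Proof. by rewrite cellE; exact: measurable_box. Qed.

Lemma vol_cell a E j : vol n (@cell a E j) = 1%E.
Proof.
rewrite cellE vol_box; last by move=> i; rewrite !mxE ler_nat.
by rewrite big1// => i _; rewrite !mxE -natrB// subSnn.
Qed.

Lemma measure_bigsetU_le (mu : {measure set (borelRn R n) -> \bar R})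
    (I : Type) (s : seq I) (P : pred I) (F : I -> set (borelRn R n)) :
  (forall i, measurable (F i)) ->
  (mu (\big[setU/set0]_(i <- s | P i) F i) <= \sum_(i <- s | P i) mu (F i))%E.
Proof.
move=> mF; elim: s => [|i s IH]; first by rewrite !big_nil measure0.
rewrite !big_cons; case: ifP => // _.
apply: le_trans (measureU2 mu _ _) _ => //; first exact: bigsetU_measurable.
by rewrite leeD2l.
Qed.

(** The closed cells overlap along their faces.  Instead of adding up the volumes of
the good ones, cover the whole box, of volume [E ^ n], by [A] and the bad cells,
so that subadditivity is enough. *)
Lemma vol_ge_card_cells a E (good : pred {ffun 'I_n -> 'I_E}) (A : set (borelRn R n)) :
  (0 < E)%N -> measurable A -> (forall j, good j -> @cell a E j `<=` A) ->
  (#|good|%:R%:E <= vol n A)%E.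
Proof.
move=> E0 mA jA.
pose Bad := \big[setU/set0]_(j | ~~ good j) @cell a E j.
pose box := [set x : borelRn R n | forall i, a%:R <= x 0 i <= (a + E)%:R].
have boxE : box = [set x | forall i, (const_mx a%:R : 'rV[R]_n) 0 i <= x 0 i <=
                      (const_mx (a + E)%:R : 'rV[R]_n) 0 i].
  by apply/seteqP; split => x /= jx i; have := jx i; rewrite !mxE.
have mBad : measurable Bad by apply: bigsetU_measurable => j _; exact: measurable_cell.
have box_sub : box `<=` A `|` Bad.
  move=> x xbox.
  have [j xj] : exists j, @cell a E j x.
    have /all_sig[j xj] : forall i, {t : 'I_E | (a + t)%:R <= x 0 i <= (a + t).+1%:R}.
      move=> i; apply: cid; have := xbox i => /andP[ax xE].
      have xa0 : 0 <= x 0 i - a%:R by rewrite subr_ge0.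
      have [tE|Et] := ltnP (Num.truncn (x 0 i - a%:R)) E.
        exists (Ordinal tE) => /=; rewrite -addnS !natrD -lerBrDl truncn_le xa0 /=.
        by rewrite -lerBlDl ltW// truncnS_gt.
      (* only the far face of the box is left: it belongs to the last cell *)
      have E1 : (E.-1 < E)%N by rewrite prednK.
      exists (Ordinal E1) => /=; rewrite -addnS prednK// xE andbT.
      rewrite natrD -lerBrDl; apply: le_trans (_ : E%:R <= _).
        by rewrite ler_nat leq_pred.
      by apply: le_trans (_ : (Num.truncn (x 0 i - a%:R))%:R <= _); rewrite ?ler_nat// truncn_le.
    by exists [ffun i => j i] => i; rewrite ffunE.
  have [gj|bj] := boolP (good j); first by left; exact: jA xj.
  by right; rewrite /Bad -bigcup_seq_cond; exists j => //=; rewrite mem_index_enum bj.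
have : (vol n box <= vol n A + vol n Bad)%E.
  apply: le_trans (_ : vol n (A `|` Bad) <= _)%E; last exact: measureU2.
  by apply: le_measure; rewrite ?inE ?boxE//; [exact: measurable_box|exact: measurableU|rewrite -boxE].
rewrite boxE vol_box; last by move=> i; rewrite !mxE ler_nat leq_addr.
under eq_bigr do rewrite !mxE -natrB ?leq_addr// addKn.
rewrite prodr_const card_ord -natrX.
have : (vol n Bad <= #|predC good|%:R%:E)%E.
  apply: le_trans (measure_bigsetU_le _ _ _ _ ) _; first exact: measurable_cell.
  rewrite (eq_bigr (fun=> 1%E)); last by move=> j _; exact: vol_cell.
  by rewrite sumEFin lee_fin sumr_const.
move=> hB hA; have {hA hB} := le_trans hA (leeD2l _ hB).
have -> : (E ^ n = #|good| + #|predC good|)%N.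
  by rewrite cardC card_ffun !card_ord.
by rewrite natrD EFinD leeD2rE.
Qed.

Section diracs.
Variables (I : finType) (f : I -> borelRn R n).

(** [msum] is indexed by natural numbers, hence the detour through [enum_val]. *)
Definition sum_dirac : {measure set (borelRn R n) -> \bar R} :=
  msum (fun k => if insub k : option 'I_#|I| is Some t
                 then \d_(f (enum_val t)) : {measure set _ -> \bar R} else mzero) #|I|.

Lemma sum_diracE A : sum_dirac A = (\sum_i \d_(f i) A)%E.
Proof.
transitivity (\sum_(k < #|I|) \d_(f (enum_val k)) A : \bar R)%E.
  by apply: eq_bigr => k _; rewrite valK.
by rewrite -(big_enum_val (fun i => \d_(f i) A : \bar R)%E).
Qed.

Lemma sum_diracT : sum_dirac setT = #|I|%:R%:E.
Proof.
rewrite sum_diracE (eq_bigr (fun=> 1%E)) => [|i _]; last by rewrite diracT.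
by rewrite sumEFin sumr_const.
Qed.

Lemma sum_dirac_ge (S : {set I}) A : (forall i, i \in S -> A (f i)) ->
  (#|S|%:R%:E <= sum_dirac A)%E.
Proof.
move=> SA; rewrite sum_diracE -sumr_const -sumEFin big_mkcond /=.
apply: lee_sum => i _; case: ifPn => iS; last exact: measure_ge0.
by rewrite diracE mem_set//; exact: SA.
Qed.

End diracs.

End measure.

(** * The perturbed lattice and the resulting bound on the best constant *)

Lemma bernoulli_ge (R : realFieldType) (n : nat) (x : R) : 0 <= x <= 1 -> 1 - n%:R * x <= (1 - x) ^+ n.
Proof.
move=> /andP[x0 x1]; elim: n => [|k IH]; first by rewrite mul0r subr0 expr0.
rewrite exprS; apply: le_trans (ler_wpM2l _ IH); last by rewrite subr_ge0.
have k0 : 0 <= k%:R * (x * x) by rewrite mulr_ge0 ?mulr_ge0.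
by rewrite -natr1; lra.
Qed.

Section theta.
Variables (R : realType) (n : nat).

Section measure_of_bits.
Variables (D : nat) (b : {ffun 'I_n -> {ffun 'I_D -> bool}}).

Definition shifted_point (k : {ffun 'I_n -> 'I_D}) : borelRn R n :=
  \row_i (k i + b i (k i))%:R.

Definition shifted_lattice : {measure set (borelRn R n) -> \bar R} :=
  sum_dirac shifted_point.

Lemma shifted_latticeT : shifted_lattice setT = (D ^ n)%:R%:E.
Proof. by rewrite /shifted_lattice sum_diracT card_ffun !card_ord. Qed.

(** A cube of radius [N] about a point of the cell contains the product of the
windows [p i + 1, ..., p i + 2 N], which [card_window] counts; dividing by the
volume [(2 N) ^ n] turns the product of these counts into [fluct_prod]. *)
Lemma maximal_shifted_lattice E (a N : nat) (j : {ffun 'I_n -> 'I_E})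
    (p q : 'I_n -> 'I_D) (x : borelRn R n) :
  (0 < N)%N -> (forall i, p i + N = a + j i)%N -> (forall i, q i = a + j i + N :> nat)%N ->
  cell a j x ->
  ((fluct_prod (2 * N%:R)^-1 p q b)%:E <= maximal shifted_lattice x)%E.
Proof.
move=> N0 pE qE jx; have N0' : 0 < N%:R :> R by rewrite ltr0n.
apply: (@le_trans _ _ (shifted_lattice (cube x N%:R) / vol n (cube x N%:R))%E); last first.
  by apply: ereal_sup_ubound; exists N%:R.
have v0 : 0 < (2 * N%:R) ^+ n :> R by rewrite exprn_gt0// mulr_gt0.
rewrite vol_cube ?(ltW N0')// inver gt_eqF// lee_pdivlMr// -EFinM.
pose P i (k : 'I_D) := (p i < k + b i k <= p i + 2 * N)%N.
apply: le_trans (@sum_dirac_ge _ _ _ shifted_point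
    [set k : {ffun 'I_n -> 'I_D} | [forall i, P i (k i)]]%SET _ _); last first.
  move=> k; rewrite inE => /forallP /= kP i; rewrite mxE.
  have /andP[ax xa] := jx i; have /andP[pk kp] := kP i.
  set y := (k i + b i (k i))%N in pk kp *; move: pk kp (pE i) => pk kp pa.
  have h1 : (a + j i).+1%:R <= (y + N)%:R :> R by rewrite ler_nat -pa ltn_add2r.
  have h2 : y%:R <= (a + j i + N)%:R :> R by rewrite ler_nat -pa -addnA addnn -mul2n.
  rewrite natrD in h1; rewrite [leRHS]natrD in h2.
  by rewrite ler_norml; apply/andP; split; lra.
rewrite card_box natr_prod lee_fin mulrC -[n in _ ^+ n]card_ord -prodr_const -big_split /=.
apply: ler_prod => i _; apply/andP; split.
  rewrite mulr_ge0 ?mulr_ge0// fluct_ge0// invr_ge0 mulr_ge0//=.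
  by rewrite invf_le1 ?mulr_gt0// -natrM ler1n; lia.
rewrite /fluct mulrDr mulr1 mulrA mulfV ?gt_eqF ?mulr_gt0// mul1r.
rewrite addrA lerBlDr -natrM -!natrD ler_nat; apply: card_window => //.
by rewrite qE -pE; lia.
Qed.

End measure_of_bits.

(** The radii are [m + s] for [s < m], and the cells are those with lowest corner
[2 m + j], so that [p j s i] and [q j s i], at distance [m + s] on either side
of that corner, run over disjoint ranges as [s] varies. *)
Lemma Theta_ge (m : nat) (L : R) : (0 < m)%N -> 0 < L ->
  2 * L ^+ 2 < (1 + (32 * m%:R ^+ 2)^-1) ^+ n ->
  8 * (1 + (m%:R ^+ 2)^-1) ^+ n <= m%:R :> R ->
  ((L / 4)%:E <= Theta R n)%E.
Proof.
move=> m0 L0 Lm mn; have m0' : 0 < m%:R :> R by rewrite ltr0n.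
(* a margin of 2 m on both sides of the cells; E makes (E / D) ^ n >= 1 / 2 *)
pose E := (8 * m * n.+1)%N; pose D := (E + 4 * m)%N.
have E0 : (0 < E)%N by rewrite /E !muln_gt0 m0.
pose J := {ffun 'I_n -> 'I_E}; pose B := {ffun 'I_n -> {ffun 'I_D -> bool}}.
have pD (j : J) (s : 'I_m) i : (j i + (m - s) < D)%N.
  by have := ltn_ord s; have := ltn_ord (j i); rewrite /D; lia.
have qD (j : J) (s : 'I_m) i : (j i + (3 * m + s) < D)%N.
  by have := ltn_ord s; have := ltn_ord (j i); rewrite /D; lia.
pose p j s i := Ordinal (pD j s i); pose q j s i := Ordinal (qD j s i).
pose h (s : 'I_m) : R := (2 * (m + s)%:R)^-1.
have hE (s : 'I_m) : [/\ 0 < h s, (4 * m%:R)^-1 <= h s & h s <= (2 * m%:R)^-1].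
  have ms : m%:R <= (m + s)%:R :> R by rewrite ler_nat leq_addr.
  have sm : (m + s)%:R <= 2 * m%:R :> R by rewrite -natrM ler_nat; have := ltn_ord s; lia.
  have ms0 : 0 < (m + s)%:R :> R by exact: lt_le_trans ms.
  rewrite /h !lef_pV2 ?posrE ?mulr_gt0// invr_gt0 mulr_gt0//.
  by split => //; lra.
have msqr : ((2 * m%:R)^-1) ^+ 2 = (m%:R ^+ 2)^-1 / 4 :> R.
  by field; rewrite gt_eqF.
have msqr' : ((4 * m%:R)^-1) ^+ 2 = (m%:R ^+ 2)^-1 / 16 :> R.
  by field; rewrite gt_eqF.
have msqr'' : (32 * m%:R ^+ 2)^-1 = (m%:R ^+ 2)^-1 / 32 :> R.
  by field; rewrite gt_eqF.
pose bad (j : J) (b : B) := [forall s, fluct_prod (h s) (p j s) (q j s) b ^+ 2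
                     <= (1 + h s ^+ 2 / 2) ^+ n / 2].
have [b bP] : exists b, (2 * #|[set j | bad j b]%SET| <= #|J|)%N.
  apply: exists_majority => [|j].
    by apply/card_gt0P; exists [ffun=> [ffun=> false]].
  apply: half_fluct_prod_large mn => //.
  - by move=> s i; rewrite -val_eqE /=; have := ltn_ord s; lia.
  - move=> s t i st /=; rewrite !inE -!val_eqE /=.
    move: st; rewrite -val_eqE /=; have := ltn_ord s; have := ltn_ord t.
    by rewrite !negb_or; lia.
  - move=> s; have [h0 _ h1] := hE s; rewrite ltW//=.
    apply: le_trans h1 _; rewrite invf_le1 ?mulr_gt0// -natrM ler1n; lia.
  - move=> s; have [h0 _ h1] := hE s.
    have : h s ^+ 2 <= (2 * m%:R)^-1 ^+ 2 by rewrite ler_sqr ?nnegrE ?invr_ge0 ?mulr_ge0// ltW.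
    by rewrite msqr; lra.
pose mu := shifted_lattice b.
have good_sub (j : J) : ~~ bad j b ->
    cell (2 * m) j `<=` [set x | L%:E < maximal mu x]%E.
  rewrite negb_forall => /existsP[s]; rewrite -ltNge => Xs x jx /=.
  apply: lt_le_trans (@maximal_shifted_lattice D b E (2 * m) (m + s) j
    (p j s) (q j s) x _ _ _ jx) => //=; last 3 first.
  - by rewrite addn_gt0 m0.
  - by move=> i; have := ltn_ord s; lia.
  - by move=> i; lia.
  rewrite -/(h s) lte_fin; set X := fluct_prod _ _ _ _ in Xs *.
  have [h0 h1 h2] := hE s.
  have X0 : 0 <= X.
    apply: prodr_ge0 => i _; apply: fluct_ge0; rewrite (ltW h0) /=.
    by apply: le_trans h2 _; rewrite invf_le1 ?mulr_gt0// -natrM ler1n; lia.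
  rewrite -ltr_sqr ?nnegrE ?(ltW L0)//; apply: lt_trans Xs.
  apply: (@lt_le_trans _ _ ((1 + (32 * m%:R ^+ 2)^-1) ^+ n / 2)); first by lra.
  rewrite ler_pM2r ?invr_gt0//.
  have : (4 * m%:R)^-1 ^+ 2 <= h s ^+ 2 by rewrite ler_sqr ?nnegrE ?invr_ge0 ?mulr_ge0// ltW.
  rewrite msqr' msqr'' => h3; have m2 : 0 <= (m%:R ^+ 2)^-1 :> R by rewrite invr_ge0 sqr_ge0.
  by rewrite lerXn2r ?nnegrE//; lra.
have vol_ge := vol_ge_card_cells E0 (measurable_maximal_gt mu L) good_sub.
have good_half : (E ^ n)%:R / 2 <= #|[pred j | ~~ bad j b]|%:R :> R.
  have : (#|[set j | bad j b]%SET| + #|[pred j | ~~ bad j b]| = E ^ n)%N.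
    rewrite -[RHS](_ : #|J| = _)%N; last by rewrite card_ffun !card_ord.
    by rewrite -[RHS](cardC [pred j | bad j b]) cardsE.
  have -> : (E ^ n)%N = #|J| by rewrite card_ffun !card_ord.
  move=> cE; rewrite ler_pdivrMr// -natrM ler_nat; lia.
have DE : (D ^ n)%:R / 2 <= (E ^ n)%:R :> R.
  have D0 : 0 < D%:R :> R by rewrite ltr0n /D; lia.
  pose x : R := (4 * m)%:R / D%:R.
  have Ex : E%:R = D%:R * (1 - x).
    by rewrite mulrBr mulr1 /x mulrC divfK ?gt_eqF// /D natrD addrK.
  have xn : n%:R * x <= 2^-1.
    rewrite /x mulrA ler_pdivrMr// -natrM.
    rewrite mulrC ler_pdivlMr// -natrM ler_nat /D /E; nia.
  have x0 : 0 <= x by rewrite divr_ge0.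
  have x1 : x <= 1 by rewrite ler_pdivrMr// mul1r ler_nat /D; lia.
  have := @bernoulli_ge R n x; rewrite x0 x1 => /(_ isT) bx.
  rewrite !natrX Ex exprMn; rewrite ler_pM2l ?exprn_gt0//; lra.
apply/ereal_infP => _ [C /= CP <-]; rewrite lee_fin.
have := CP mu L L0; rewrite shifted_latticeT -EFinM.
move=> /(le_trans (lee_wpmul2l _ vol_ge)); rewrite lee_fin (ltW L0) => /(_ isT).
rewrite -EFinM lee_fin => LC.
have Dn0 : 0 < (D ^ n)%:R :> R by rewrite ltr0n expn_gt0 /D; lia.
rewrite -(ler_pM2r Dn0); apply: le_trans LC.
have : (D ^ n)%:R / 4 <= #|[pred j | ~~ bad j b]|%:R :> R by lra.
move=> /(ler_wpM2l (ltW L0)); lra.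
Qed.

End theta.

(** * Growth of the bound with the dimension *)

Section growth.
Variable R : realType.

Lemma expR1_le4 : expR 1 <= 4 :> R.
Proof.
have h : 2^-1 <= expR (- 2^-1) :> R by have := expR_ge1Dx (- 2^-1 : R); lra.
have h1 : expR (2^-1) <= 2 :> R.
  by rewrite -[expR _]invrK -expRN -[leRHS]invrK lef_pV2 ?posrE ?expR_gt0// invr_gt0.
rewrite (_ : 1 = 2^-1 + 2^-1 :> R); last by field.
by rewrite expRD; have := expR_gt0 (2^-1 : R); nra.
Qed.

Lemma expR_half_le (v : R) : 0 <= v <= 1 -> expR (v / 2) <= 1 + v.
Proof.
move=> /andP[v0 v1]; rewrite -[expR _]invrK -expRN.
have h := expR_ge1Dx (- (v / 2)); have e0 := expR_gt0 (- (v / 2)).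
by rewrite -div1r ler_pdivrMr//; nra.
Qed.

(** The right-hand side of the estimate is a constant times a small power of [n].
With [a = 1 + ln n] and [m] between one and two times [sqrt (512 n / a)], the
power [(1 + 1 / m^2) ^ n] is at most [expR (a / 512)], hence at most
[m / 8], and [(1 + 1 / 32m^2) ^ n] is at least [expR (a / (256 * 512))]. *)
Lemma Theta_ge_expR (n : nat) : (1 <= n)%N ->
  ((expR ((1 + ln n%:R) / 512 / 512) / 8)%:E <= Theta R n)%E.
Proof.
move=> n1; set a : R := 1 + ln n%:R.
have n0 : 0 < n%:R :> R by rewrite ltr0n.
have a1 : 1 <= a by rewrite lerDl ln_ge0// ler1n.
have a0 : 0 < a by exact: lt_le_trans a1.
have nE : expR a = expR 1 * n%:R by rewrite expRD lnK// posrE.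
have an : a <= n%:R by rewrite -[leRHS]lnK ?posrE//; exact: expR_ge1Dx.
pose y := 512 * n%:R / a; pose r := Num.sqrt y.
have y1 : 1 <= y by rewrite ler_pdivlMr// mul1r; lra.
have y0 : 0 < y by exact: lt_le_trans y1.
have r2 : r ^+ 2 = y by rewrite sqr_sqrtr// ltW.
have r1 : 1 <= r by rewrite -sqrtr1 ler_wsqrtr.
have r0 : 0 < r by exact: lt_le_trans r1.
have ny : n%:R / y = a / 512.
  by rewrite /y; field; rewrite !gt_eqF.
have yE : y = 512 * n%:R / a by [].
clearbody r; clearbody y.
pose m := (Num.truncn r).+1.
have rm : r < m%:R by exact: truncnS_gt.
have mr : m%:R <= 2 * r.
  have : (Num.truncn r)%:R <= r by rewrite truncn_le ltW.
  by rewrite /m -natr1; lra.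
have m0 : 0 < m%:R :> R by rewrite ltr0n.
pose u : R := (m%:R ^+ 2)^-1.
have u0 : 0 < u by rewrite invr_gt0 exprn_gt0.
have uy : u <= y^-1.
  by rewrite lef_pV2 ?posrE ?exprn_gt0// -r2 ler_sqr ?nnegrE ltW.
have yu : y^-1 <= 4 * u.
  have -> : 4 * u = (m%:R ^+ 2 / 4)^-1 by rewrite invfM invrK mulrC.
  rewrite lef_pV2 ?posrE ?divr_gt0 ?exprn_gt0// -r2.
  have : m%:R ^+ 2 <= (2 * r) ^+ 2.
    by rewrite ler_sqr ?nnegrE// mulr_ge0// ltW.
  by lra.
have u1 : u <= 1 by apply: le_trans uy _; rewrite invf_le1.
rewrite (_ : expR _ / 8 = expR (a / 512 / 512) / 2 / 4); last by field.
apply: (@Theta_ge _ n m).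
- by [].
- by apply: divr_gt0; [exact: expR_gt0|exact: ltr0Sn].
- have -> : 2 * (expR (a / 512 / 512) / 2) ^+ 2 = expR (a / 512 / 256) / 2.
    have -> : a / 512 / 256 = a / 512 / 512 + a / 512 / 512 by field.
    by rewrite expRD; field.
  apply: (@lt_le_trans _ _ (expR (a / 512 / 256))).
    by rewrite ltr_pdivrMr// ltr_pMr ?expR_gt0// ltr1n.
  rewrite invfM -/u.
  apply: (@le_trans _ _ (expR (32^-1 * u / 2) ^+ n)); last first.
    by rewrite lerXn2r ?nnegrE ?expR_ge0//; [lra|apply: expR_half_le; lra].
  rewrite -expRM_natl ler_expR -ny.
  have : n%:R * y^-1 <= n%:R * (4 * u) by rewrite ler_pM2l.
  by lra.
- apply: le_trans (_ : 8 * expR (a / 512) <= _).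
    rewrite ler_pM2l//; apply: (@le_trans _ _ (expR u ^+ n)).
      by rewrite lerXn2r ?nnegrE ?expR_ge0 ?expR_ge1Dx//; lra.
    by rewrite -expRM_natl ler_expR -ny ler_pM2l.
  apply: le_trans (ltW rm).
  rewrite -ler_sqr ?nnegrE ?mulr_ge0 ?expR_ge0 ?(ltW r0)// r2 yE ler_pdivlMr//.
  have e1 : expR (a / 512) ^+ 2 <= expR (a / 2).
    by rewrite expr2 -expRD ler_expR; lra.
  have e2 : a <= 2 * expR (a / 2) by have := expR_ge1Dx (a / 2); lra.
  have e3 : expR (a / 2) * expR (a / 2) = expR 1 * n%:R.
    by rewrite -expRD -nE; congr expR; field.
  have e4 : expR 1 * n%:R <= 4 * n%:R :> R by exact: (ler_wpM2r (ltW n0) expR1_le4).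
  have e5 : expR (a / 512) ^+ 2 * a <= expR (a / 2) * (2 * expR (a / 2)).
    exact: ler_pM (sqr_ge0 _) (ltW a0) e1 e2.
  by rewrite exprMn; lra.
Qed.

End growth.

Theorem theorem1 (R : realType) (eps : R) (heps0 : 0 < eps) (heps1 : eps < 1) :
  exists c : R, 0 < c /\
    forall n : nat, (1 <= n)%N ->
      ((c * (ln n%:R) `^ (1 - eps))%:E <= Theta R n)%E.
Proof.
exists (512^-1 / 512 / 8); split; first by lra.
move=> n n1; apply: le_trans (Theta_ge_expR _ n1); rewrite lee_fin.
have l0 : 0 <= ln n%:R :> R by rewrite ln_ge0// ler1n.
have powle : ln n%:R `^ (1 - eps) <= 1 + ln n%:R.
  apply: (@le_trans _ _ ((1 + ln n%:R) `^ (1 - eps))).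
    by apply: ge0_ler_powR; rewrite ?nnegrE; lra.
  by apply: ler1_powR; lra.
have := expR_ge1Dx ((1 + ln n%:R) / 512 / 512 : R).
move: (_ `^ _) powle (expR _) => x xl e; lra.
Qed.
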